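(* Let $(H;\langle\cdot,\cdot\rangle)$ be an infinite dimensional Hilbert space over the real or complex number field $\mathbb{K}$, and $(e_i)_{i\in\mathbb{N}}$ an orthonormal family in $H$. Assume that $\boldsymbol\lambda=(\lambda_i)_{i\in\mathbb{N}},\ \boldsymbol\mu=(\mu_i)_{i\in\mathbb{N}}\in\ell^2(\mathbb{K})$ and $r_1,r_2>0$ are such that $$\sum_{i=1}^\infty|\lambda_i|^2>r_1^2,\qquad\sum_{i=1}^\infty|\mu_i|^2>r_2^2 .$$ If $x,y\in H$ are such that $$\left\|x-\sum_{i=1}^\infty\lambda_ie_i\right\|\le r_1,\qquad\left\|y-\sum_{i=1}^\infty\mu_ie_i\right\|\le r_2,$$ then $$\begin{aligned}\left|\langle x,y\rangle-\sum_{i=1}^\infty\langle x,e_i\rangle\langle e_i,y\rangle\right|&\le\frac{r_1r_2}{\sqrt{\sum_{i=1}^\infty|\lambda_i|^2-r_1^2}\sqrt{\sum_{i=1}^\infty|\mu_i|^2-r_2^2}}\cdot\sqrt{\sum_{i=1}^\infty|\langle x,e_i\rangle|^2\sum_{i=1}^\infty|\langle y,e_i\rangle|^2}\\&\le\frac{r_1r_2\|x\|\,\|y\|}{\sqrt{\sum_{i=1}^\infty|\lambda_i|^2-r_1^2}\sqrt{\sum_{i=1}^\infty|\mu_i|^2-r_2^2}} .\end{aligned}$$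
   Context: The inner product is linear in its first argument and $\|z\|=\sqrt{\langle z,z\rangle}$. The family $(e_i)_{i\in\mathbb{N}}$ is orthonormal (not assumed complete): $\langle e_i,e_j\rangle=0$ for $i\ne j$ and $\|e_i\|=1$. $\ell^2(\mathbb{K})$ is the space of sequences $(a_i)_{i\in\mathbb{N}}$ in $\mathbb{K}$ with $\sum_{i=1}^\infty|a_i|^2<\infty$; for $(a_i)\in\ell^2(\mathbb{K})$ the series $\sum_{i=1}^\infty a_ie_i$ converges in $H$. *)

(* Defs.v *)
From HB Require Import structures.
From mathcomp Require Import all_boot all_order all_algebra.
From mathcomp Require Import sesquilinear complex.
From mathcomp Require Import all_classical all_reals all_analysis.

Set Implicit Arguments.
Unset Strict Implicit.
Unset Printing Implicit Defensive.

Import Order.TTheory GRing.Theory Num.Theory.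
Import numFieldNormedType.Exports.

Local Open Scope ring_scope.
Local Open Scope classical_set_scope.

Inductive scalar_kind : Set := RealScalars | ComplexScalars.

Definition scalar_field (R : realType) (k : scalar_kind) : numFieldType :=
  match k with RealScalars => R : numFieldType | ComplexScalars => R[i] end.

Definition of_real (R : realType) (k : scalar_kind) : R -> scalar_field R k :=
  match k with
  | RealScalars => fun a => a
  | ComplexScalars => fun a => (a%:C)%C
  end.

Definition scalar_re (R : realType) (k : scalar_kind) : scalar_field R k -> R :=
  match k with
  | RealScalars => fun a => a
  | ComplexScalars => fun a => complex.Re a
  end.

Definition scalar_conj (R : realType) (k : scalar_kind) :
    scalar_field R k -> scalar_field R k :=
  match k with
  | RealScalars => fun a => a
  | ComplexScalars => fun a => (a^*)%C
  end.

Arguments of_real {R k}.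
Arguments scalar_re {R k}.
Arguments scalar_conj {R k}.

(* The norm of a numFieldType takes its values in the field itself; this is
   the same modulus read as a real number. *)
Definition modulus (R : realType) (k : scalar_kind) (a : scalar_field R k) : R :=
  scalar_re `|a|.

(* A {dot _ for _} is linear in its first argument, conjugate-linear in the
   second one, and positive definite. The last field identifies the norm
   (hence the topology and the completeness) of the carrier with
   sqrt <z, z>. *)
Record hilbertSpace (R : realType) (k : scalar_kind) := HilbertSpace {
  hilbert_sort :> completeNormedModType (scalar_field R k);
  inner : {dot hilbert_sort for @scalar_conj R k};
  norm_innerE : forall z : hilbert_sort,
    `|z| = of_real (Num.sqrt (scalar_re (inner z z)))
}.

(* <z, z> is real, so taking its real part only moves it from the scalar field
   to R. *)
Definition hnorm (R : realType) (k : scalar_kind) (H : hilbertSpace R k)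
  (z : H) : R := Num.sqrt (scalar_re (inner H z z)).

(* [limn] is total: the value is meaningful only when the series converges. *)
Notation "\sum_ ( i '<oo' ) F" := (limn (series (fun i => F))) : ring_scope.

Definition finite_dimensional (K : numFieldType) (V : lmodType K) : Prop :=
  exists (n : nat) (b : 'I_n -> V),
    forall v : V, exists a : 'I_n -> K, v = \sum_(i < n) a i *: b i.

Definition orthonormal_family (R : realType) (k : scalar_kind)
    (H : hilbertSpace R k) (e : nat -> H) : Prop :=
  (forall i j, i <> j -> inner H (e i) (e j) = 0) /\
  (forall i, hnorm (e i) = 1).

Definition ell2 (R : realType) (k : scalar_kind) (a : nat -> scalar_field R k) :
  Prop := cvgn (series (fun i => modulus (a i) ^+ 2)).

(* Main.v *)
Require Import Defs.
From HB Require Import structures.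
From mathcomp Require Import all_boot all_order all_algebra.
From mathcomp Require Import sesquilinear complex.
From mathcomp Require Import all_classical all_reals all_analysis.
From mathcomp Require Import ring lra.

Set Implicit Arguments.
Unset Strict Implicit.
Unset Printing Implicit Defensive.

Import Order.TTheory GRing.Theory Num.Theory.
Import numFieldNormedType.Exports.

Local Open Scope ring_scope.
Local Open Scope classical_set_scope.

(** Let [P x] be the sum of [<x, e_i> e_i]. Since [H] is complete, every series
    with square-summable coefficients converges ([ell2_is_cvg_series]), so
    [P x] exists, and [x - P x] is orthogonal to every such series
    ([residual_orthogonal]). Two identities follow:

    - [<x, y>] minus the sum of the [<x, e_i> <e_i, y>] is
      [<x - P x, y - P y>] ([inner_residual]);
    - [|x|^2 = |x - P x|^2 + A] with [A] the sum of the [|<x, e_i>|^2]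
      ([bessel_eq]).

    By the Cauchy-Schwarz inequality it thus suffices to bound [|x - P x|] and
    [|y - P y|] separately. Put [u] for the sum of the [lambda_i e_i] and
    [L = |u|^2] for the sum of the [|lambda_i|^2] ([parseval]). Expanding
    [|x - u|^2 <= r^2] and applying the arithmetic-geometric mean inequality
    gives a converse of Cauchy-Schwarz,
    [|x|^2 (L - r^2) <= (Re <x, u>)^2] ([reverse_cauchy_schwarz]). But
    [<x, u> = <P x, u>], so the right-hand side is at most [A L], and replacing
    [|x|^2] by [|x - P x|^2 + A] leaves [|x - P x|^2 (L - r^2) <= r^2 A]
    ([reverse_bessel]). Multiplying the bounds for [x] and [y] gives the first
    inequality; the second one is Bessel's inequality [A <= |x|^2]
    ([sqrt_bessel]). *)

(** * The real or complex scalar field *)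

Section ScalarField.
Variables (R : realType) (k : scalar_kind).
Local Notation K := (scalar_field R k).
Implicit Types (a b : K) (t u : R).

Fact of_real_zmod_morphism : zmod_morphism (@of_real R k).
Proof. by case: k => t u //=; rewrite rmorphB. Qed.

Fact of_real_monoid_morphism : monoid_morphism (@of_real R k).
Proof. by case: k; split=> // t u /=; rewrite rmorphM. Qed.

HB.instance Definition _ :=
  GRing.isZmodMorphism.Build R K (@of_real R k) of_real_zmod_morphism.
HB.instance Definition _ :=
  GRing.isMonoidMorphism.Build R K (@of_real R k) of_real_monoid_morphism.

Fact scalar_conj_zmod_morphism : zmod_morphism (@scalar_conj R k).
Proof. by case: k => a b //=; rewrite rmorphB. Qed.

Fact scalar_conj_monoid_morphism : monoid_morphism (@scalar_conj R k).
Proof.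
by case: k; split=> //; [exact: conjc1 | move=> a b /=; rewrite rmorphM].
Qed.

HB.instance Definition _ :=
  GRing.isZmodMorphism.Build K K (@scalar_conj R k) scalar_conj_zmod_morphism.
HB.instance Definition _ :=
  GRing.isMonoidMorphism.Build K K (@scalar_conj R k)
    scalar_conj_monoid_morphism.

Fact scalar_re_zmod_morphism : zmod_morphism (@scalar_re R k).
Proof. by case: k => //= -[a1 a2] [b1 b2]. Qed.

HB.instance Definition _ :=
  GRing.isZmodMorphism.Build K R (@scalar_re R k) scalar_re_zmod_morphism.

Lemma of_realK : cancel (@of_real R k) scalar_re.
Proof. by case: k. Qed.

Lemma ler_of_real t u : (of_real t <= of_real u :> K) = (t <= u).
Proof. by case: k => //=; exact: lecR. Qed.

Lemma ltr_of_real t u : (of_real t < of_real u :> K) = (t < u).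
Proof. by rewrite !lt_neqAle ler_of_real (can_eq of_realK). Qed.

Lemma normr_of_real t : `|of_real t : K| = of_real `|t|.
Proof. by case: k => //=; rewrite normc_def /= expr0n addr0 sqrtr_sqr. Qed.

(** The order of the complex field compares only numbers of equal imaginary
    part, so that the radii of balls are real: this turns an epsilon of the
    scalar field into an epsilon of [R]. *)
Lemma ge0_of_realE a : 0 <= a -> a = of_real (scalar_re a).
Proof.
by case: k a => //= a a0; rewrite RRe_real // ger0_real.
Qed.

Lemma modulusE a : `|a| = of_real (modulus a).
Proof. exact: ge0_of_realE. Qed.

Lemma modulus_ge0 a : 0 <= modulus a.
Proof. by rewrite -ler_of_real -modulusE rmorph0. Qed.

Lemma modulusM a b : modulus (a * b) = modulus a * modulus b.
Proof. by apply: (can_inj of_realK); rewrite rmorphM /= -!modulusE normrM. Qed.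

Lemma mul_scalar_conj a : a * scalar_conj a = of_real (modulus a ^+ 2).
Proof.
rewrite rmorphXn /= -modulusE.
case: k a => /= a; last by rewrite sqr_normc.
by rewrite real_normK ?num_real // expr2.
Qed.

Lemma scalar_re_conj a : scalar_re (scalar_conj a) = scalar_re a.
Proof. by case: k a => //= -[]. Qed.

Lemma scalar_re_le_modulus a : `|scalar_re a| <= modulus a.
Proof.
rewrite -ler_of_real -modulusE.
by case: k a => //= a; exact: normc_ge_Re.
Qed.

Lemma of_real_cvg (u_ : nat -> R) l :
  u_ n @[n --> \oo] --> l ->
  (of_real (u_ n) : K) @[n --> \oo] --> (of_real l : K).
Proof.
move=> /cvgrPdist_lt ul; apply/cvgrPdist_lt => eps eps0.
have epsE := ge0_of_realE (ltW eps0).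
have {}/ul : 0 < scalar_re eps by rewrite -ltr_of_real -epsE rmorph0.
apply: filterS => n.
by rewrite -rmorphB normr_of_real epsE ltr_of_real of_realK.
Qed.

End ScalarField.

Lemma lipschitz_cvg (K : numFieldType) (V W : normedModType K) (M : K)
    (f : V -> W) (u_ : nat -> V) l :
  0 <= M -> (forall a b, `|f a - f b| <= M * `|a - b|) ->
  u_ n @[n --> \oo] --> l -> f (u_ n) @[n --> \oo] --> f l.
Proof.
move=> M0 lipf /cvgrPdist_lt ul; apply/cvgrPdist_lt => eps eps0.
have M1 : 0 < M + 1 by rewrite ltr_wpDl.
apply: filterS (ul _ (divr_gt0 eps0 M1)) => n un.
apply: le_lt_trans (lipf _ _) _.
rewrite ltr_pdivlMr // mulrC in un; apply: le_lt_trans un.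
by rewrite ler_wpM2r // lerDl.
Qed.

(** * Geometry of a Hilbert space *)

Section HilbertSpace.
Variables (R : realType) (k : scalar_kind) (H : hilbertSpace R k).
Local Notation K := (scalar_field R k).
Local Notation "<( x , y )>" := (inner H x y) (format "<( x ,  y )>").
Implicit Types (x y z : H) (a : K).

Lemma innerC x y : <(x, y)> = scalar_conj <(y, x)>.
Proof. by rewrite hermC expr0 mul1r. Qed.

Lemma innerZl a x y : <(a *: x, y)> = a * <(x, y)>.
Proof. by rewrite linearZl_LR. Qed.

Lemma innerZr a x y : <(x, a *: y)> = scalar_conj a * <(x, y)>.
Proof. by rewrite linearZr_LR. Qed.

Lemma inner_suml I (r : seq I) (P : pred I) (E : I -> H) y :
  <(\sum_(i <- r | P i) E i, y)> = \sum_(i <- r | P i) <(E i, y)>.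
Proof. 
rewrite innerC linear_sumr rmorph_sum; apply: eq_bigr => i _ /=.
by rewrite -innerC.
Qed.

Lemma inner_self_ge0 x : 0 <= <(x, x)>.
Proof.
by have [->|x0] := eqVneq x 0; rewrite ?linear0r// ltW// neq0_dnorm_gt0.
Qed.

Lemma hnorm_ge0 x : 0 <= hnorm x.
Proof. exact: sqrtr_ge0. Qed.

Lemma normrE x : `|x| = of_real (hnorm x).
Proof. exact: norm_innerE. Qed.

Lemma inner_selfE x : <(x, x)> = of_real (hnorm x ^+ 2).
Proof.
rewrite /hnorm sqr_sqrtr; first exact/ge0_of_realE/inner_self_ge0.
rewrite -(@ler_of_real _ k) -ge0_of_realE ?rmorph0; exact: inner_self_ge0.
Qed.

Lemma sqr_hnorm x : hnorm x ^+ 2 = scalar_re <(x, x)>.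
Proof. by rewrite inner_selfE of_realK. Qed.

Lemma hnormZ a x : hnorm (a *: x) = modulus a * hnorm x.
Proof.
apply: (can_inj (@of_realK R k)).
by rewrite rmorphM /= -modulusE -!normrE normrZ.
Qed.

Lemma sqr_hnormB x y :
  hnorm (x - y) ^+ 2 = hnorm x ^+ 2 + hnorm y ^+ 2 - 2 * scalar_re <(x, y)>.
Proof.
rewrite !sqr_hnorm linearBl !linearBr /= !raddfB /= [<(y, x)>]innerC.
rewrite scalar_re_conj; ring.
Qed.

Lemma pythagoras x y : <(x - y, y)> = 0 ->
  hnorm x ^+ 2 = hnorm (x - y) ^+ 2 + hnorm y ^+ 2.
Proof.
rewrite linearBl => /eqP; rewrite subr_eq0 => /eqP xy.
rewrite sqr_hnormB xy -sqr_hnorm; ring.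
Qed.

(** Subtracting from [x] its projection [a y] on the line of [y] leaves a vector
    orthogonal to [y], so that [|a y| = |<x, y>| / |y|] is at most [|x|] by
    Pythagoras. *)
Lemma cauchy_schwarz x y : modulus <(x, y)> <= hnorm x * hnorm y.
Proof.
have [->|y0] := eqVneq y 0.
  by rewrite linear0r /modulus normr0 raddf0 mulr_ge0 ?hnorm_ge0.
have ny0 : 0 < hnorm y.
  by rewrite -(@ltr_of_real _ k) rmorph0 -normrE normr_gt0.
pose a := <(x, y)> * of_real (hnorm y ^+ 2)^-1.
have xay : <(x - a *: y, a *: y)> = 0.
  rewrite innerZr linearBl /= innerZl inner_selfE -mulrA -rmorphM.
  rewrite mulVf ?expf_neq0 ?gt_eqF //.
  by rewrite rmorph1 mulr1 subrr mulr0.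
have := pythagoras xay.
have : modulus a * hnorm y = modulus <(x, y)> / hnorm y.
  rewrite modulusM {2}/modulus normr_of_real of_realK.
  rewrite ger0_norm ?invr_ge0 ?sqr_ge0 //.
  by field; rewrite gt_eqF.
rewrite hnormZ => -> xE.
rewrite -ler_pdivrMr // -(@ler_pXn2r _ 2) ?nnegrE ?hnorm_ge0 //.
  by rewrite xE lerDr sqr_ge0.
by rewrite divr_ge0 ?modulus_ge0 ?hnorm_ge0.
Qed.

(** Expanding [|x - u|^2 <= r^2] gives [|x|^2 + (|u|^2 - r^2) <= 2 Re <x, u>],
    and the left-hand side is at least twice the geometric mean of its two
    terms. *)
Lemma reverse_cauchy_schwarz x u (r : R) :
  hnorm (x - u) <= r -> r ^+ 2 <= hnorm u ^+ 2 ->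
  hnorm x ^+ 2 * (hnorm u ^+ 2 - r ^+ 2) <= scalar_re <(x, u)> ^+ 2.
Proof.
move=> xu; rewrite -subr_ge0 => gap0.
have r0 : 0 <= r := le_trans (hnorm_ge0 _) xu.
have : hnorm (x - u) ^+ 2 <= r ^+ 2 by rewrite ler_pXn2r ?nnegrE ?hnorm_ge0.
rewrite sqr_hnormB => xu2.
have le_re : hnorm x ^+ 2 + (hnorm u ^+ 2 - r ^+ 2) <= 2 * scalar_re <(x, u)>.
  by lra.
have sum0 := addr_ge0 (sqr_ge0 (hnorm x)) gap0.
have := ler_pM sum0 sum0 le_re le_re.
have := sqr_ge0 (hnorm x ^+ 2 - (hnorm u ^+ 2 - r ^+ 2)).
by lra.
Qed.

(** Cauchy-Schwarz for the norm valued in the scalar field: it makes the inner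
    product Lipschitz, hence continuous, in each argument. *)
Lemma normr_inner_le x y : `|<(x, y)>| <= `|x| * `|y|.
Proof. by rewrite modulusE !normrE -rmorphM /= ler_of_real cauchy_schwarz. Qed.

Lemma inner_cvgl (u_ : nat -> H) l y :
  u_ n @[n --> \oo] --> l -> <(u_ n, y)> @[n --> \oo] --> (<(l, y)> : K).
Proof.
apply: (@lipschitz_cvg K H K `|y| (fun x => <(x, y)>)) => // a b.
by rewrite -linearBl mulrC normr_inner_le.
Qed.

Lemma inner_cvgr (u_ : nat -> H) l x :
  u_ n @[n --> \oo] --> l -> <(x, u_ n)> @[n --> \oo] --> (<(x, l)> : K).
Proof.
apply: (@lipschitz_cvg K H K `|x| (fun y => <(x, y)>)) => // a b.
by rewrite -linearBr normr_inner_le.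
Qed.

End HilbertSpace.

(** * Fourier series along an orthonormal family *)

Section Orthonormal.
Variables (R : realType) (k : scalar_kind) (H : hilbertSpace R k).
Variables (e : nat -> H) (he : orthonormal_family e).
Local Notation K := (scalar_field R k).
Local Notation "<( x , y )>" := (inner H x y) (format "<( x ,  y )>").
Implicit Types (x y : H) (c : nat -> K).

Lemma inner_orthonormal i j : <(e i, e j)> = (i == j)%:R.
Proof.
have [eo e1] := he; have [->|/eqP ij] := eqVneq i j; last exact: eo.
by rewrite inner_selfE e1 expr1n rmorph1.
Qed.

Lemma inner_fourier_sum c m n j : (m <= j < n)%N ->
  <(\sum_(m <= i < n) c i *: e i, e j)> = c j.
Proof.
move=> jmn; rewrite inner_suml.
rewrite (bigD1_seq j) ?iota_uniq ?mem_index_iota //=.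
rewrite innerZl inner_orthonormal eqxx mulr1 big1 ?addr0 // => i ij.
by rewrite innerZl inner_orthonormal (negbTE ij) mulr0.
Qed.

Lemma sqr_hnorm_fourier_sum c m n :
  hnorm (\sum_(m <= i < n) c i *: e i) ^+ 2 =
  \sum_(m <= i < n) modulus (c i) ^+ 2.
Proof.
rewrite sqr_hnorm linear_sumr raddf_sum /=.
rewrite big_seq [RHS]big_seq; apply: eq_bigr => i.
rewrite mem_index_iota => imn.
by rewrite innerZr inner_fourier_sum // mulrC mul_scalar_conj of_realK.
Qed.

(** Bessel's inequality comes first for partial sums, because it is what makes
    the coefficients of [x] square-summable, hence [fourier_proj] meaningful. *)
Lemma bessel_partial x n :
  \sum_(0 <= i < n) modulus <(x, e i)> ^+ 2 <= hnorm x ^+ 2.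
Proof.
rewrite -sqr_hnorm_fourier_sum.
set s := \sum_(0 <= i < n) _.
suff /pythagoras -> : <(x - s, s)> = 0 by rewrite lerDr sqr_ge0.
rewrite linear_sumr /= big_seq big1 // => i; rewrite mem_index_iota => imn.
by rewrite innerZr linearBl /= inner_fourier_sum // subrr mulr0.
Qed.

Lemma ell2_fourier x : ell2 (fun i => <(x, e i)>).
Proof.
apply: nondecreasing_is_cvgn.
  by apply: nondecreasing_series => i _ _; exact: sqr_ge0.
by exists (hnorm x ^+ 2) => _ [n _ <-]; exact: bessel_partial.
Qed.

(** By [sqr_hnorm_fourier_sum] the blocks of the vector series have as squared
    norms the blocks of the real series, so that one is Cauchy when the other
    is; completeness of [H] does the rest. *)
Lemma ell2_is_cvg_series c : ell2 c -> cvgn (series (fun i => c i *: e i)).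
Proof.
move=> /cauchy_cvgP/(@cauchy_seriesP _ R) cc.
apply/cauchy_cvgP/(@cauchy_seriesP _ H) => eps eps0.
have epsE := ge0_of_realE (ltW eps0).
have eps0R : 0 < scalar_re eps by rewrite -(@ltr_of_real _ k) -epsE rmorph0.
have := cc _ (exprn_gt0 2 eps0R).
apply: filterS => -[m n] /= mn.
rewrite normrE epsE ltr_of_real -(@ltr_pXn2r _ 2) ?nnegrE ?hnorm_ge0 ?ltW //.
by rewrite sqr_hnorm_fourier_sum; apply: le_lt_trans mn; exact: ler_norm.
Qed.

Lemma inner_series_cvg c x : ell2 c ->
  series (fun i => <(x, e i)> * scalar_conj (c i)) n @[n --> \oo] -->
    (<(x, \sum_(i <oo) c i *: e i)> : K).
Proof.
move=> cc; apply: cvg_trans (inner_cvgr (x := x) (ell2_is_cvg_series cc)).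
apply: near_eq_cvg; near=> n.
rewrite /series /= linear_sumr /=; apply: eq_bigr => i _.
by rewrite innerZr mulrC.
Unshelve. all: by end_near. Qed.

Lemma inner_series c x : ell2 c ->
  <(x, \sum_(i <oo) c i *: e i)> =
  \sum_(i <oo) <(x, e i)> * scalar_conj (c i).
Proof. by move=> cc; apply/esym/cvg_lim => //; exact: inner_series_cvg. Qed.

Lemma inner_series_basis c j : ell2 c ->
  <(\sum_(i <oo) c i *: e i, e j)> = c j.
Proof.
move=> cc; have cj := inner_cvgl (y := e j) (ell2_is_cvg_series cc).
apply/esym; apply: (cvg_unique _ _ cj) => //.
(* The j-th coefficient of the partial sums is c j as soon as n > j. *)
apply: cvg_near_cst; near=> n.
apply: inner_fourier_sum; rewrite leq0n /=; near: n; exact: nbhs_infty_gt.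
Unshelve. all: by end_near. Qed.

Lemma parseval c : ell2 c ->
  hnorm (\sum_(i <oo) c i *: e i) ^+ 2 = \sum_(i <oo) modulus (c i) ^+ 2.
Proof.
move=> cc; apply: (can_inj (@of_realK R k)); rewrite -inner_selfE.
rewrite inner_series //.
have /of_real_cvg cl := cc.
apply: cvg_lim => //; apply: cvg_trans (cl k); apply: near_eq_cvg; near=> n.
rewrite /series /= rmorph_sum; apply: eq_bigr => i _ /=.
by rewrite inner_series_basis // mul_scalar_conj.
Unshelve. all: by end_near. Qed.

(** The orthogonal projection of [x] on the closed linear span of the family. *)
Definition fourier_proj x : H := \sum_(i <oo) <(x, e i)> *: e i.

(** Both sides are the same series, as [x] and its projection have the same
    coefficients along the family. *)
Lemma inner_fourier_proj c x : ell2 c ->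
  <(fourier_proj x, \sum_(i <oo) c i *: e i)> =
  <(x, \sum_(i <oo) c i *: e i)>.
Proof.
move=> cc; rewrite !inner_series //; congr (limn (series _)); apply/funext => i.
by rewrite inner_series_basis //; exact: ell2_fourier.
Qed.

Lemma sqr_hnorm_fourier_proj x :
  hnorm (fourier_proj x) ^+ 2 = \sum_(i <oo) modulus <(x, e i)> ^+ 2.
Proof. exact/parseval/ell2_fourier. Qed.

Lemma residual_orthogonal c x : ell2 c ->
  <(x - fourier_proj x, \sum_(i <oo) c i *: e i)> = 0.
Proof. by move=> cc; rewrite linearBl /= inner_fourier_proj ?subrr. Qed.

Lemma bessel_eq x : hnorm x ^+ 2 =
  hnorm (x - fourier_proj x) ^+ 2 + \sum_(i <oo) modulus <(x, e i)> ^+ 2.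
Proof.
rewrite -sqr_hnorm_fourier_proj; apply: pythagoras.
exact/residual_orthogonal/ell2_fourier.
Qed.

Lemma bessel x : \sum_(i <oo) modulus <(x, e i)> ^+ 2 <= hnorm x ^+ 2.
Proof. by rewrite bessel_eq lerDr sqr_ge0. Qed.

(** The residual [y - fourier_proj y] is orthogonal to [fourier_proj x], so the
    left-hand side is [<(x, y)> - <(x, fourier_proj y)>]. *)
Lemma inner_residual x y :
  <(x - fourier_proj x, y - fourier_proj y)> =
  <(x, y)> - \sum_(i <oo) <(x, e i)> * <(e i, y)>.
Proof.
rewrite linearBl /= [X in _ - X]innerC residual_orthogonal ?rmorph0 ?subr0;
  last exact: ell2_fourier.
rewrite linearBr /= inner_series; last exact: ell2_fourier.
congr (_ - limn (series _)); apply/funext => i.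
by rewrite -innerC.
Qed.

Lemma sqrt_bessel x :
  Num.sqrt (\sum_(i <oo) modulus <(x, e i)> ^+ 2) <= hnorm x.
Proof.
rewrite -[leRHS]ger0_norm ?hnorm_ge0 // -sqrtr_sqr.
by rewrite ler_sqrt ?sqr_ge0 ?bessel.
Qed.

(** A vector within [r] of a series of norm greater than [r] is not far from
    the span of the family, in proportion to the norm of its projection.
    Replacing [x] by its projection in the right-hand side of
    [reverse_cauchy_schwarz] bounds it by [A L], where [A] and [L] are the sums
    over [x] and over [c]; since [|x|^2 = |x - fourier_proj x|^2 + A], the
    terms [A L] cancel. *)
Lemma reverse_bessel c x r : ell2 c ->
  r ^+ 2 < \sum_(i <oo) modulus (c i) ^+ 2 ->
  hnorm (x - \sum_(i <oo) c i *: e i) <= r ->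
  hnorm (x - fourier_proj x) *
      Num.sqrt (\sum_(i <oo) modulus (c i) ^+ 2 - r ^+ 2) <=
    r * Num.sqrt (\sum_(i <oo) modulus <(x, e i)> ^+ 2).
Proof.
move=> cc; rewrite -parseval // -sqr_hnorm_fourier_proj.
set u := \sum_(i <oo) c i *: e i => ru xu.
have r0 : 0 <= r := le_trans (hnorm_ge0 _) xu.
have gap0 : 0 <= hnorm u ^+ 2 - r ^+ 2 by rewrite subr_ge0 ltW.
have re_le : scalar_re <(x, u)> ^+ 2 <= (hnorm (fourier_proj x) * hnorm u) ^+ 2.
  rewrite -real_normK ?num_real // ler_pXn2r ?nnegrE ?mulr_ge0 ?hnorm_ge0 //.
  apply: le_trans (scalar_re_le_modulus _) _.
  by rewrite -inner_fourier_proj // cauchy_schwarz.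
have := le_trans (reverse_cauchy_schwarz xu (ltW ru)) re_le.
rewrite bessel_eq -sqr_hnorm_fourier_proj exprMn => le_proj.
rewrite -(@ler_pXn2r _ 2) ?nnegrE ?mulr_ge0 ?hnorm_ge0 ?sqrtr_ge0 //.
rewrite !exprMn (sqr_sqrtr gap0) (sqr_sqrtr (sqr_ge0 _)).
lra.
Qed.

End Orthonormal.

Theorem theorem7 (R : realType) (k : scalar_kind) (H : hilbertSpace R k)
  (Hinf : ~ finite_dimensional H)
  (e : nat -> H) (he : orthonormal_family e)
  (lambda mu : nat -> scalar_field R k) (hlambda : ell2 lambda) (hmu : ell2 mu)
  (r1 r2 : R) (hr1 : 0 < r1) (hr2 : 0 < r2)
  (hlambda_r1 : \sum_(i <oo) modulus (lambda i) ^+ 2 > r1 ^+ 2)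
  (hmu_r2 : \sum_(i <oo) modulus (mu i) ^+ 2 > r2 ^+ 2)
  (x y : H)
  (hx : hnorm (x - \sum_(i <oo) lambda i *: e i) <= r1)
  (hy : hnorm (y - \sum_(i <oo) mu i *: e i) <= r2) :
  modulus (inner H x y - \sum_(i <oo) inner H x (e i) * inner H (e i) y)
    <= r1 * r2 /
       (Num.sqrt (\sum_(i <oo) modulus (lambda i) ^+ 2 - r1 ^+ 2) *
        Num.sqrt (\sum_(i <oo) modulus (mu i) ^+ 2 - r2 ^+ 2)) *
       Num.sqrt ((\sum_(i <oo) modulus (inner H x (e i)) ^+ 2) *
                 \sum_(i <oo) modulus (inner H y (e i)) ^+ 2) /\
  r1 * r2 /
    (Num.sqrt (\sum_(i <oo) modulus (lambda i) ^+ 2 - r1 ^+ 2) *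
     Num.sqrt (\sum_(i <oo) modulus (mu i) ^+ 2 - r2 ^+ 2)) *
    Num.sqrt ((\sum_(i <oo) modulus (inner H x (e i)) ^+ 2) *
              \sum_(i <oo) modulus (inner H y (e i)) ^+ 2)
    <= r1 * r2 * hnorm x * hnorm y /
       (Num.sqrt (\sum_(i <oo) modulus (lambda i) ^+ 2 - r1 ^+ 2) *
        Num.sqrt (\sum_(i <oo) modulus (mu i) ^+ 2 - r2 ^+ 2)).

Proof.
have sx0 : 0 < Num.sqrt (\sum_(i <oo) modulus (lambda i) ^+ 2 - r1 ^+ 2).
  by rewrite sqrtr_gt0 subr_gt0.
have sy0 : 0 < Num.sqrt (\sum_(i <oo) modulus (mu i) ^+ 2 - r2 ^+ 2).
  by rewrite sqrtr_gt0 subr_gt0.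
have := reverse_bessel he hlambda hlambda_r1 hx.
have := reverse_bessel he hmu hmu_r2 hy.
rewrite -inner_residual // sqrtrM; last first.
  by rewrite -sqr_hnorm_fourier_proj ?sqr_ge0.
have := sqrt_bessel he x; have := sqrt_bessel he y.
move: (Num.sqrt _) sx0 (Num.sqrt _) sy0
  (Num.sqrt _) (sqrtr_ge0 (\sum_(i <oo) modulus (inner H x (e i)) ^+ 2))
  (Num.sqrt _) (sqrtr_ge0 (\sum_(i <oo) modulus (inner H y (e i)) ^+ 2)).
move=> sx sx0 sy sy0 ax ax0 ay ay0 ay_le ax_le dy_le dx_le.
split.
  apply: le_trans (cauchy_schwarz _ _) _.
  have -> : r1 * r2 / (sx * sy) * (ax * ay) = (r1 * ax / sx) * (r2 * ay / sy).
    by field; rewrite !gt_eqF.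
  by apply: ler_pM; rewrite ?hnorm_ge0 ?ler_pdivlMr.
rewrite -[r1 * r2 * hnorm x * hnorm y]mulrA [leRHS]mulrAC.
rewrite ler_pM2l ?divr_gt0 ?mulr_gt0 //.
exact: ler_pM.
Qed.
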